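(* There is an algorithm running in $O(n\log n)$ time that, given a sequence $A$ of $n$ real numbers, returns a permutation $A'$ of $A$ with $\mathrm{value}(A')\le 2\,OPT(A)$, i.e. a 2-approximation algorithm for the Sorting a Sequence by Scores problem; moreover, on every instance of the restricted version of that problem it returns a permutation $A'$ with $\mathrm{value}(A')\le \tfrac{3}{2}\,OPT(A)$, i.e. it is a $3/2$-approximation algorithm for the restricted version.
   Context: For a sequence $A=\langle a_1,\ldots,a_n\rangle$ of reals, the score of a sequence is the sum of its elements (the empty sequence has score $0$), and $\mathrm{value}(A)$ is the maximum score of a contiguous subsequence $\langle a_{i+1},\ldots,a_j\rangle$, $0\le i\le j\le n$ (the empty subsequence included). The Sorting a Sequence by Scores (SSS) problem: given $A$, find a permutation $A'$ of $A$ minimizing $\mathrm{value}(A')$; $OPT(A)$ denotes this minimum. The restricted version of SSS consists of the instances $A$ for which there are positive integers $k$ and $s$ such that $n=4k-1$, all elements of $A$ are integers bounded by a polynomial in $k$, exactly $k-1$ elements are negative and each equals $-s$, every positive element $a_i$ satisfies $s/4<a_i<s/2$, and the sum of all elements of $A$ equals $s$. *)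

(* Defs.v *)
From mathcomp Require Import all_boot all_order all_algebra.
From mathcomp Require Import all_classical all_reals all_analysis.

Set Implicit Arguments.
Unset Strict Implicit.
Unset Printing Implicit Defensive.

Import Order.TTheory GRing.Theory Num.Theory.
Import numFieldNormedType.Exports.

Local Open Scope ring_scope.

Section Scores.
Variable R : realType.
Implicit Types A B : seq R.

Definition score A : R := \sum_(a <- A) a.

(* [drop i (take j A)] is <a_(i+1), ..., a_j>.  The initial value 0 of the
   iterated maximum is itself a term (i = j = 0). *)
Definition value A : R :=
  \big[Num.max/0]_(j < (size A).+1)
    \big[Num.max/0]_(i < (size A).+1 | (i <= j)%N) score (drop i (take j A)).

(* The initial value of the iterated minimum is itself a term, since A is one
   of the permutations of A. *)
Definition OPT A : R := \big[Num.min/value A]_(B <- permutations A) value B.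

(* "Bounded by a polynomial in k" only makes sense for a class of instances,
   so the class is indexed by the bounding polynomial q. *)
Definition restricted (q : {poly R}) A : Prop :=
  exists k s : nat,
    [/\ (0 < k)%N /\ (0 < s)%N,
        size A = (4 * k - 1)%N,
        forall a, a \in A -> a \is a Num.int /\ `|a| <= q.[k%:R],
        count (fun a => a < 0) A = (k - 1)%N /\
          (forall a, a \in A -> a < 0 -> a = - s%:R)
      & (forall a, a \in A -> 0 < a -> s%:R / 4%:R < a < s%:R / 2%:R) /\
          score A = s%:R].

End Scores.

(* The real RAM with unit costs, programmed with structured commands.  There
   are two memories, both indexed by nat: an index memory holding natural
   numbers, with addition, truncated subtraction and comparisons, and a real
   memory holding exact real numbers, with field operations and comparisons.
   No operation converts a real number into an index (no rounding), and
   programs contain no real constants other than natural numbers. *)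

(* [Ind k] is indirect addressing, through cell k of the index memory. *)
Inductive loc := Dir of nat | Ind of nat.

(* The first location is the destination.  I: index memory, R: real memory. *)
Inductive instr :=
  | ISet of loc & nat
  | IMov of loc & loc
  | IAdd of loc & loc & loc
  | ISub of loc & loc & loc
  | RSet of loc & nat
  | RMov of loc & loc
  | RAdd of loc & loc & loc
  | RSub of loc & loc & loc
  | RMul of loc & loc & loc
  | RDiv of loc & loc & loc.

Inductive test :=
  | ILe of loc & loc
  | ILt of loc & loc
  | RLe of loc & loc
  | RLt of loc & loc.

Inductive cmd :=
  | Skip
  | Do of instr
  | Seq of cmd & cmd
  | If of test & cmd & cmd
  | While of test & cmd.

Section Semantics.
Variable R : realType.

Record state := State { imem : nat -> nat; rmem : nat -> R }.

Definition addr (st : state) (l : loc) : nat :=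
  match l with Dir k => k | Ind k => imem st k end.

Definition iget st l : nat := imem st (addr st l).
Definition rget st l : R := rmem st (addr st l).

Definition iset st l (v : nat) : state :=
  State [eta imem st with addr st l |-> v] (rmem st).
Definition rset st l (v : R) : state :=
  State (imem st) [eta rmem st with addr st l |-> v].

(* Division by zero is a failure: the machine does not halt. *)
Definition step (i : instr) (st : state) : option state :=
  match i with
  | ISet d c => Some (iset st d c)
  | IMov d x => Some (iset st d (iget st x))
  | IAdd d x y => Some (iset st d (iget st x + iget st y)%N)
  | ISub d x y => Some (iset st d (iget st x - iget st y)%N)
  | RSet d c => Some (rset st d c%:R)
  | RMov d x => Some (rset st d (rget st x))
  | RAdd d x y => Some (rset st d (rget st x + rget st y))
  | RSub d x y => Some (rset st d (rget st x - rget st y))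
  | RMul d x y => Some (rset st d (rget st x * rget st y))
  | RDiv d x y =>
      if rget st y == 0 then None else Some (rset st d (rget st x / rget st y))
  end.

Definition holds (b : test) (st : state) : bool :=
  match b with
  | ILe x y => (iget st x <= iget st y)%N
  | ILt x y => (iget st x < iget st y)%N
  | RLe x y => rget st x <= rget st y
  | RLt x y => rget st x < rget st y
  end.

(* [exec c st t st']: started in st, c halts in st' after t time units; every
   instruction and every evaluation of a test costs one unit. *)
Inductive exec : cmd -> state -> nat -> state -> Prop :=
  | ExecSkip st : exec Skip st 1 st
  | ExecDo i st st' : step i st = Some st' -> exec (Do i) st 1 st'
  | ExecSeq c1 c2 st1 st2 st3 t1 t2 :
      exec c1 st1 t1 st2 -> exec c2 st2 t2 st3 ->
      exec (Seq c1 c2) st1 (t1 + t2) st3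
  | ExecIfT b c1 c2 st st' t :
      holds b st -> exec c1 st t st' -> exec (If b c1 c2) st t.+1 st'
  | ExecIfF b c1 c2 st st' t :
      ~~ holds b st -> exec c2 st t st' -> exec (If b c1 c2) st t.+1 st'
  | ExecWhileF b c st : ~~ holds b st -> exec (While b c) st 1 st
  | ExecWhileT b c st1 st2 st3 t1 t2 :
      holds b st1 -> exec c st1 t1 st2 -> exec (While b c) st2 t2 st3 ->
      exec (While b c) st1 (t1 + t2).+1 st3.

(* The length of A is in cell 0 of the index memory, the elements of A are in
   the first cells of the real memory, and all other cells contain 0. *)
Definition init (A : seq R) : state :=
  State (fun k => if k == 0%N then size A else 0%N) (fun k => nth 0 A k).

(* The output has the length of the input and replaces it in memory. *)
Definition returns_within (p : cmd) (A B : seq R) (t : nat) : Prop :=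
  exists t' st, [/\ (t' <= t)%N, exec p (init A) t' st
                  & B = mkseq (rmem st) (size A)].

(* A single program p, for inputs of every length, computes the function f on
   finite sequences, in worst-case time T n on inputs of length n. *)
Definition computes_in_time (p : cmd) (f : seq R -> seq R) (T : nat -> nat) :=
  forall A, returns_within p A (f A) (T (size A)).

End Semantics.

(* Main.v *)
Require Import Defs.
From mathcomp Require Import all_boot all_order all_algebra.
From mathcomp Require Import all_classical all_reals all_analysis.
From mathcomp Require Import zify lra.
Import Order.TTheory GRing.Theory Num.Theory.
Import numFieldNormedType.Exports.
Local Open Scope classical_set_scope.
Local Open Scope ring_scope.

Set Implicit Arguments.
Unset Strict Implicit.
Unset Printing Implicit Defensive.

(* Running Kadane's scan on an arrangement B of value V shows that the sum of
   max(x, -V) over the elements x of B is at most V, whatever the arrangement.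
   Hence OPT is at least the least M >= 0 that dominates every element and
   satisfies sum max(x, -M) <= M.  After sorting, this M is the maximum of 0, of
   the elements and of the quotients (x_i + ... + x_(n-1)) / (i + 1), so that it
   takes linear time to compute.  The output is built greedily, with a running
   sum c of the truncated elements max(x, -M): while c <= M the largest
   remaining element comes next, and otherwise the smallest one.  Then c stays
   between 0 and M + a, where a bounds all elements, until the nonnegative
   elements are exhausted, so the value is at most M + a <= OPT + a.  In general
   a <= OPT; in the restricted version a = s / 2 and OPT >= s. *)

(** * Value of the greedy arrangement *)

Section Value.
Context {R : realType}.
Implicit Types (s A B p q r : seq R) (a c x M V : R).

(** * Scores and values of contiguous subsequences *)

Lemma score_cons x s : score (x :: s) = x + score s.
Proof. by rewrite /score big_cons. Qed.

Lemma score_cat s1 s2 : score (s1 ++ s2) = score s1 + score s2.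
Proof. by rewrite /score big_cat. Qed.

Lemma score_nil : score [::] = 0 :> R.
Proof. by rewrite /score big_nil. Qed.

Lemma value_ge0 A : 0 <= value A.
Proof.
exact: bigmax_ge_id.
Qed.

Lemma value_ge p q r : score q <= value (p ++ q ++ r).
Proof.
rewrite /value.
have hj : (size p + size q < (size (p ++ q ++ r)).+1)%N by rewrite !size_cat; lia.
have hi : (size p < (size (p ++ q ++ r)).+1)%N by rewrite !size_cat; lia.
apply: (le_trans _ (le_bigmax _ _ (Ordinal hj))).
have hij : (Ordinal hi <= Ordinal hj)%N by rewrite /= leq_addr.
apply: (le_trans _ (le_bigmax_cond _ _ hij)) => /=.
by rewrite catA -size_cat take_size_cat // drop_size_cat.
Qed.

Lemma value_le A V : 0 <= V ->
  (forall p q r, A = p ++ q ++ r -> score q <= V) -> value A <= V.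
Proof.
move=> V0 h; rewrite /value.
apply/bigmax_leP; split=> // j _; apply/bigmax_leP; split=> // i ij.
apply: (h (take i (take j A)) _ (drop j A)).
by rewrite catA !cat_take_drop.
Qed.

Lemma value_perm_ge_OPT A V :
  (forall B, perm_eq B A -> V <= value B) -> V <= OPT A.
Proof.
move=> h; rewrite /OPT big_seq; elim/big_ind: _ => [|x y hx hy|B].
- by apply: h.
- by rewrite le_min hx.
by rewrite mem_permutations => /h.
Qed.

(** * Truncated sums and the lower bound on the optimum *)

Definition trunc_score M s : R := \sum_(x <- s) Num.max x (- M).

Lemma trunc_score_cons M x s :
  trunc_score M (x :: s) = Num.max x (- M) + trunc_score M s.
Proof. by rewrite /trunc_score big_cons. Qed.

(* Kadane's scan: an element below [- V] resets the running sum. *)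
Lemma trunc_score_kadane V c s :
  (forall p q, s = p ++ q -> c + score p <= V) ->
  (forall p q r, s = p ++ q ++ r -> score q <= V) -> c + trunc_score V s <= V.
Proof.
elim: s c => [|x s IH] c hp hv.
  by have := hp [::] [::] erefl; rewrite score_nil /trunc_score big_nil.
have hv' p q r : s = p ++ q ++ r -> score q <= V.
  by move=> e; apply: (hv (x :: p) q r); rewrite e.
rewrite trunc_score_cons; case: (lerP x (- V)) => hx.
  (* The truncated element contributes [- V] and [c <= V], so restarting the sum from 0 can only
     increase the left-hand side. *)
  have cV := hp [::] (x :: s) erefl; rewrite score_nil in cV.
  suff : trunc_score V s <= V by lra.
  rewrite -[leLHS]add0r; apply: IH => // p q e.
  by rewrite add0r; apply: (hv' [::] p q).
rewrite addrA; apply: IH => // p q e.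
by rewrite -addrA -score_cons; apply: (hp (x :: p) q); rewrite e.
Qed.

Lemma trunc_score_value s : trunc_score (value s) s <= value s.
Proof.
rewrite -[leLHS]add0r; apply: trunc_score_kadane => [p q ->|p q r ->].
  by rewrite add0r; apply: (value_ge [::]).
exact: value_ge.
Qed.

(* The smallest M >= 0 that dominates every element of the sorted sequence s
   and satisfies trunc_score M s <= M; both conditions are necessary for
   M to be the value of a permutation of s. *)
Fixpoint bound s (k : nat) : R :=
  if k is k'.+1 then
    Num.max (Num.max (bound s k') (score (drop k' s) / k'.+1%:R)) (nth 0 s k')
  else 0.

Lemma bound_ge0 s k : 0 <= bound s k.
Proof. by elim: k => //= k IH; rewrite !le_max IH. Qed.

Lemma bound_nth s k i : (i < k)%N -> nth 0 s i <= bound s k.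
Proof.
elim: k => // k IH; rewrite ltnS leq_eqVlt => /orP[/eqP ->|/IH h] /=.
  by rewrite le_max lexx orbT.
by rewrite !le_max h.
Qed.

Lemma bound_drop s k i : (i < k)%N -> score (drop i s) <= i.+1%:R * bound s k.
Proof.
elim: k => // k IH; rewrite ltnS leq_eqVlt => /orP[/eqP ->|/IH h] /=.
  by rewrite mulrC -ler_pdivrMr // !le_max lexx orbT.
by apply: le_trans h _; rewrite ler_pM2l // !le_max lexx.
Qed.

Lemma bound_le s k V : 0 <= V ->
  (forall i, (i < k)%N -> nth 0 s i <= V /\ score (drop i s) <= i.+1%:R * V) ->
  bound s k <= V.
Proof.
move=> V0; elim: k => //= k IH h.
rewrite !ge_max IH /=; last by move=> i ik; apply: h; lia.
by have [h1 h2] := h k (ltnSn k); rewrite h1 ler_pdivrMr // mulrC h2.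
Qed.

(** Each of the [i] dropped elements contributes at least [- V] to the truncated sum, and every
    other element contributes at least itself. *)
Lemma score_drop_trunc V s i : (i <= size s)%N ->
  score (drop i s) <= i%:R * V + trunc_score V s.
Proof.
elim: s i => [|x s IH] [|i] //= hi.
- by rewrite score_nil /trunc_score big_nil mul0r addr0.
- have := IH 0%N isT; rewrite drop0 !mul0r !add0r score_cons trunc_score_cons.
  by apply: lerD; rewrite le_max lexx.
have := IH i hi; rewrite trunc_score_cons -natr1 mulrDl mul1r.
have : - V <= Num.max x (- V) by rewrite le_max lexx orbT.
lra.
Qed.

(** [trunc_score] is invariant under permutation, so the bound from Kadane's scan of [B] holds for
    [s] as well. Comparing it with the suffix scores of [s] bounds every quotient in [bound]. *)
Lemma bound_le_value s B : perm_eq B s -> bound s (size s) <= value B.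
Proof.
move=> sB; apply: bound_le (value_ge0 B) _ => i si; split.
  have : nth 0 s i \in B by rewrite (perm_mem sB) mem_nth.
  case/splitPr=> p1 p2.
  by have := value_ge p1 [:: nth 0 s i] p2; rewrite /score big_seq1.
have := score_drop_trunc (value B) (ltnW si).
have : trunc_score (value B) s <= value B.
  by apply: le_trans (trunc_score_value B); rewrite /trunc_score (perm_big _ sB).
by rewrite -natr1 mulrDl mul1r; lra.
Qed.

Lemma trunc_score_ge M s : score s <= trunc_score M s.
Proof.
by have := score_drop_trunc M (leq0n (size s)); rewrite drop0 mul0r add0r.
Qed.

Lemma trunc_score_id M s : all (fun x => - M <= x) s -> trunc_score M s = score s.
Proof.
move=> /allP h; rewrite /trunc_score /score; apply: eq_big_seq => x /h hx.
by apply/max_idPl.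
Qed.

(** In a sorted sequence the truncated elements form a prefix. The index [k] counts those already
    removed: each contributed [- M], which allows one more [M] on the right. At the first element
    that is not truncated, the sum is the score of the remaining suffix, bounded by the hypothesis
    at [i = 0]. *)
Lemma trunc_score_sorted M s k : 0 <= M -> sorted <=%R s ->
  (forall i, (i < size s)%N -> score (drop i s) <= (k + i).+1%:R * M) ->
  trunc_score M s <= k.+1%:R * M.
Proof.
move=> M0; elim: s k => [|x s IH] k ss h.
  by rewrite /trunc_score big_nil mulr_ge0.
case: (lerP (- M) x) => hx.
  rewrite trunc_score_id; first by have := h 0%N isT; rewrite drop0 addn0.
  apply/allP => y; rewrite inE => /orP[/eqP -> //|ys].
  apply: le_trans hx _.
  by move: ss; rewrite /= (path_sortedE le_trans) => /andP[/allP /(_ _ ys)].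
have : trunc_score M s <= k.+2%:R * M.
  apply: IH => [|i si]; first exact: path_sorted ss.
  by have := h i.+1 si; rewrite addnS addSn.
rewrite trunc_score_cons; move/ltW/max_idPr: hx => ->.
by rewrite -[k.+2%:R]natr1 mulrDl mul1r; lra.
Qed.

Lemma trunc_score_bound s : sorted <=%R s ->
  trunc_score (bound s (size s)) s <= bound s (size s).
Proof.
move=> ss; rewrite -[leRHS]mul1r.
by apply: (@trunc_score_sorted _ s 0) (bound_ge0 s _) ss (@bound_drop s _).
Qed.

(** * The greedy arrangement and its approximation ratios *)

(** The recursion is on the number [k] of elements still to be placed. With [k = size s] the list is
    nonempty at each step, so the defaults of [last] and [head] are never returned. *)
Fixpoint greedy M c s (k : nat) : seq R :=
  if k is k'.+1 then
    let x := if c <= M then last 0 s else head 0 s in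
    let s' := if c <= M then take (size s).-1 s else behead s in
    x :: greedy M (c + Num.max x (- M)) s' k'
  else [::].

Lemma perm_greedy M c s : perm_eq (greedy M c s (size s)) s.
Proof.
move: {2 3}(size s) (erefl (size s)) => k.
elim: k s c => [|k IH] s c sk /=; first by rewrite (size0nil sk).
case: ifP => _.
  case/lastP: s sk => // s x; rewrite size_rcons => -[sk].
  rewrite last_rcons /= -cats1 take_size_cat //.
  by rewrite perm_sym perm_catC /= perm_cons perm_sym IH.
by case: s sk => // x s [sk] /=; rewrite perm_cons IH.
Qed.

Lemma size_greedy M c s k : size (greedy M c s k) = k.
Proof. by elim: k c s => //= k IH c s; rewrite IH. Qed.

Lemma max_trunc_le0 M x : 0 <= M -> x <= 0 -> Num.max x (- M) <= 0.
Proof. by move=> M0 x0; rewrite ge_max x0 oppr_le0. Qed.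

Lemma trunc_score_le0 M s : 0 <= M -> all (fun x => x <= 0) s ->
  trunc_score M s <= 0.
Proof.
move=> M0 /allP h; rewrite /trunc_score big_seq; apply: sumr_le0 => x /h.
exact: max_trunc_le0.
Qed.

(* As long as the running truncated sum c exceeds M, a negative element is
   left, because the truncated sum of everything is at most M; truncation
   keeps c nonnegative, so that c plus a sum starting here dominates that sum. *)
Lemma greedy_le M c a s : 0 <= M -> 0 <= a -> sorted <=%R s ->
  all (fun x => x <= a) s -> c <= M + a -> c + trunc_score M s <= M ->
  0 <= c \/ all (fun x => x <= 0) s ->
  (forall p q, greedy M c s (size s) = p ++ q ->
     c + trunc_score M p <= M + a) /\
  (forall p q r, greedy M c s (size s) = p ++ q ++ r -> score q <= M + a).
Proof.
move=> M0 a0; move: {2 3 4}(size s) (erefl (size s)) => k.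
elim: k s c => [|k IH] s c sk ss sa ca cs hc.
  split=> [[|//] q _|[|//] [|//] r _].
    by rewrite /trunc_score big_nil addr0.
  by rewrite score_nil addr_ge0.
have [s0|sN0] := boolP (all (fun x => x <= 0) s).
  (* Once no positive element remains, truncated sums over the rest of the output are nonpositive,
     so both bounds are immediate. *)
  have sub p : (forall x, x \in p -> x \in greedy M c s k.+1) ->
      trunc_score M p <= 0.
    move=> h; apply: trunc_score_le0 => //; apply/allP => x /h.
    by rewrite -sk (perm_mem (perm_greedy M c s)); apply/allP: x.
  split=> [p q e|p q r e].
    apply: le_trans ca; rewrite gerDl; apply: sub => x xp.
    by rewrite e mem_cat xp.
  apply: (le_trans (trunc_score_ge M q)).
  apply: (@le_trans _ _ 0); last by rewrite addr_ge0.
  by apply: sub => x xq; rewrite e !mem_cat xq orbT.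
have {hc} c0 : 0 <= c by case: hc => // h; rewrite h in sN0.
pose x := if c <= M then last 0 s else head 0 s.
pose s' := if c <= M then take (size s).-1 s else behead s.
have [sk' ss' perm_s x0] : [/\ size s' = k, sorted <=%R s', perm_eq (x :: s') s
    & if c <= M then 0 <= x else x <= 0].
  rewrite /x /s'; case: ifP => [_|/negbT cM].
    case/lastP: s sk ss sN0 {sa cs x s'} => // s x; rewrite size_rcons => -[sk].
    rewrite last_rcons /= -cats1 take_size_cat // => ss sN0.
    have [sss sxs] : sorted <=%R s /\ all (<= x) s.
      move: ss; rewrite !(sorted_pairwise le_trans) pairwise_cat.
      case/and3P=> h1 -> _.
      split=> //.
      by move: h1; rewrite allrel1r.
    split=> //; first by rewrite -cat1s perm_catC.
    (* The last element is the largest one: if it were negative, all elements would be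
       nonpositive. *)
    case: leP => // /ltW xle; move: sN0; rewrite all_cat /= xle !andbT.
    by move/negP; case; apply: sub_all sxs => y /= /le_trans; apply.
  case: s sk ss cs {sN0 sa x s'} => // x s [sk] /= ss cs; split=> //.
    exact: path_sorted ss.
  (* If the smallest element were positive, the truncated sum of [s] would be positive too, which
     together with [c > M] contradicts [cs]. *)
  case: (leP x 0) => // x0; move: cs; rewrite trunc_score_cons.
  have : 0 <= trunc_score M s.
    rewrite /trunc_score big_seq; apply: sumr_ge0 => y ys; rewrite le_max.
    move: ss; rewrite (path_sortedE le_trans) => /andP[/allP /(_ y ys) h _].
    by rewrite (le_trans (ltW x0) h).
  have : 0 < Num.max x (- M) by rewrite lt_max x0.
  rewrite -ltNge in cM; lra.
have xa : x <= a.
  by move/allP: sa; apply; rewrite -(perm_mem perm_s) mem_head.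
have sa' : all (fun y => y <= a) s'.
  by move: sa; rewrite -(perm_all _ perm_s) => /andP[].
have trs : trunc_score M s = Num.max x (- M) + trunc_score M s'.
  by rewrite -trunc_score_cons /trunc_score (perm_big _ perm_s).
set c' := c + Num.max x (- M).
(* If [c <= M], the step adds a number between 0 and [a]; if [c > M], it adds one between [- M] and
   0. *)
have [c'0 c'a] : 0 <= c' /\ c' <= M + a.
  rewrite /c'; move: x0; case: (lerP c M) => cM x0; case: (lerP x (- M)); lra.
have c's : c' + trunc_score M s' <= M by rewrite /c' -addrA -trs.
have [IH1 IH2] := IH s' c' sk' ss' sa' c'a c's (or_introl c'0).
rewrite /= -/x -/s' -/c'.
have pre p q : x :: greedy M c' s' k = p ++ q -> c + trunc_score M p <= M + a.
  case: p => [|y p]; first by rewrite /trunc_score big_nil addr0.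
  case=> <- e; rewrite trunc_score_cons addrA; exact: IH1 e.
split=> // -[|y p] q r; last by case=> _; apply: IH2.
move/(pre q r); apply: le_trans; apply: le_trans (trunc_score_ge M q) _.
by rewrite lerDr.
Qed.

Definition balanced A : seq R :=
  let s := sort <=%R A in greedy (bound s (size s)) 0 s (size s).

Lemma perm_balanced A : perm_eq (balanced A) A.
Proof. by apply: perm_trans (perm_greedy _ _ _) _; rewrite perm_sort. Qed.

Lemma bound_le_OPT A : bound (sort <=%R A) (size (sort <=%R A)) <= OPT A.
Proof.
apply: value_perm_ge_OPT => B BA; apply: bound_le_value.
by rewrite (perm_trans BA) // perm_sym perm_sort.
Qed.

Lemma value_balanced A a : 0 <= a -> (forall x, x \in A -> x <= a) ->
  value (balanced A) <= OPT A + a.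
Proof.
move=> a0 ha; rewrite /balanced; set s := sort _ _; set M := bound _ _.
have M0 : 0 <= M := bound_ge0 _ _.
apply: (@le_trans _ _ (M + a)); last by rewrite lerD2r bound_le_OPT.
have ss : sorted <=%R s by apply: sort_sorted => x y; apply: le_total.
apply: value_le; first by rewrite addr_ge0.
have sa : all (<= a) s by apply/allP => x; rewrite mem_sort => /ha.
have c0 : 0 <= M + a by rewrite addr_ge0.
have Ms : 0 + trunc_score M s <= M by rewrite add0r; apply: trunc_score_bound.
by have [_] := greedy_le M0 a0 ss sa c0 Ms (or_introl (lexx 0)).
Qed.

Lemma balanced_2approx A : value (balanced A) <= 2%:R * OPT A.
Proof.
rewrite mulr_natl mulr2n; set s := sort <=%R A.
(* Here the bound on the elements is [OPT A] itself. *)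
apply: value_balanced.
  exact: le_trans (bound_ge0 s (size s)) (bound_le_OPT A).
move=> x; rewrite -(mem_sort <=%R) => xA; apply: le_trans (bound_le_OPT A).
by rewrite -{1}(nth_index 0 xA); apply: bound_nth; rewrite index_mem.
Qed.

Lemma balanced_restricted (q : {poly R}) A : restricted q A ->
  value (balanced A) <= 3%:R / 2%:R * OPT A.
Proof.
case=> k [s [[_ s0] _ _ _ [hpos hs]]].
(* The whole of a permutation is one of its contiguous subsequences, and its score is [s]. *)
have sOPT : s%:R <= OPT A.
  apply: value_perm_ge_OPT => B BA.
  have := value_ge [::] B [::]; rewrite /= cats0; apply: le_trans.
  by rewrite -hs /score (perm_big _ BA).
have s0' : 0 <= s%:R / 2%:R :> R by rewrite divr_ge0.
have h := @value_balanced A _ s0'; set v := value _ in h *.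
have : v <= OPT A + s%:R / 2%:R.
  apply: h => x xA; case: (lerP x 0) => [x0|x0]; first exact: le_trans x0 s0'.
  by case/andP: (hpos x xA x0) => _ /ltW.
lra.
Qed.

End Value.

(** * Total correctness with time credits *)

Section Logic.
Context {R : realType}.
Implicit Types (st : state R) (Q I : nat -> state R -> Prop) (t : nat).

(* Total-correctness weakest precondition with time credits: the run may
   spend t credits, and the postcondition receives what is left. *)
Definition wp c Q t st : Prop :=
  exists t' st', [/\ exec c st t' st', (t' <= t)%N & Q (t - t')%N st'].

Lemma wp_skip Q t st : (0 < t)%N -> Q t.-1 st -> wp Skip Q t st.
Proof.
by move=> t0 q; exists 1%N, st; split=> //; [exact: ExecSkip|rewrite subn1].
Qed.

Lemma wp_do i Q t st st' :
  step i st = Some st' -> (0 < t)%N -> Q t.-1 st' -> wp (Do i) Q t st.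
Proof.
by move=> h t0 q; exists 1%N, st'; split=> //; [exact: ExecDo|rewrite subn1].
Qed.

Lemma wp_seq c1 c2 Q t st : wp c1 (wp c2 Q) t st -> wp (Seq c1 c2) Q t st.
Proof.
case=> t1 [st1 [e1 h1 [t2 [st2 [e2 h2 q]]]]].
exists (t1 + t2)%N, st2; split; [exact: ExecSeq e1 e2|lia|].
by rewrite subnDA.
Qed.

Lemma wp_if b c1 c2 Q t st : (0 < t)%N ->
  (holds b st -> wp c1 Q t.-1 st) -> (~~ holds b st -> wp c2 Q t.-1 st) ->
  wp (If b c1 c2) Q t st.
Proof.
move=> t0 h1 h2; have [hb|hb] := boolP (holds b st).
  have [t1 [st1 [e1 l1 q]]] := h1 hb; exists t1.+1, st1.
  by split; [exact: ExecIfT|lia|have -> : (t - t1.+1 = t.-1 - t1)%N by lia].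
have [t1 [st1 [e1 l1 q]]] := h2 hb; exists t1.+1, st1.
by split; [exact: ExecIfF|lia|have -> : (t - t1.+1 = t.-1 - t1)%N by lia].
Qed.

(* The loop terminates because every evaluation of the test costs a credit. *)
Lemma wp_while I b c Q t st :
  (forall t st, I t st -> (0 < t)%N) ->
  (forall t st, I t st -> holds b st -> wp c I t.-1 st) ->
  (forall t st, I t st -> ~~ holds b st -> Q t.-1 st) ->
  I t st -> wp (While b c) Q t st.
Proof.
move=> hpos hbody hexit; have [k] := ubnP t.
elim: k t st => // k IH t st tk It; have t0 := hpos _ _ It.
have [hb|hb] := boolP (holds b st); last first.
  by exists 1%N, st; split=> //; [exact: ExecWhileF|rewrite subn1; exact: hexit].
have [t1 [st1 [e1 l1 It1]]] := hbody _ _ It hb.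
have [|t2 [st2 [e2 l2 q]]] := IH _ _ _ It1; first by lia.
exists (t1 + t2).+1, st2; split; [exact: ExecWhileT hb e1 e2|lia|].
by have -> : (t - (t1 + t2).+1 = t.-1 - t1 - t2)%N by lia.
Qed.

Definition block (l : seq instr) := foldr (fun i => Seq (Do i)) Skip l.

(** Straight-line code is run by computation, so that the premise of [wp_block] is discharged by
    [reflexivity]. *)
Fixpoint steps (l : seq instr) st : option (state R) :=
  if l is i :: l' then if step i st is Some st' then steps l' st' else None
  else Some st.

(** A block costs one unit more than its length, because of the final [Skip]. *)
Lemma wp_block l Q t st st' : steps l st = Some st' -> (size l < t)%N ->
  Q (t - (size l).+1)%N st' -> wp (block l) Q t st.
Proof.
elim: l t st => [|i l IH] t st /=.
  by case=> <- t0; rewrite subn1 => q; apply: wp_skip.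
case E: (step i st) => [st1|//] h lt q.
apply: wp_seq; apply: (wp_do E); first by lia.
apply: IH h _ _; first by lia.
by have -> : (t.-1 - (size l).+1 = t - (size l).+2)%N by lia.
Qed.

End Logic.

Arguments block : simpl never.

(** * Arrays laid out in memory *)

Section Arrays.
Context {R : realType}.
Implicit Types (rm : nat -> R) (s : seq R) (a b i : nat).

Definition stored rm b s : Prop :=
  forall i, (i < size s)%N -> rm (b + i)%N = nth 0 s i.

Lemma stored_set rm b s a v : stored rm b s ->
  (a < b)%N || (b + size s <= a)%N -> stored [eta rm with a |-> v] b s.
Proof. by move=> h ab i si /=; rewrite h //; case: eqP => // ?; lia. Qed.

Lemma stored_rcons rm b s a v : stored rm b s -> a = (b + size s)%N ->
  stored [eta rm with a |-> v] b (rcons s v).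
Proof.
move=> h -> i; rewrite size_rcons nth_rcons ltnS leq_eqVlt /=.
case/orP=> [/eqP ->|si]; first by rewrite eqxx ltnn eqxx.
by rewrite eqn_add2l si ltn_eqF // h.
Qed.

Lemma stored_mkseq rm s : stored rm 0 s -> s = mkseq rm (size s).
Proof.
move=> h; apply: (@eq_from_nth _ 0); rewrite ?size_mkseq // => i si.
by rewrite nth_mkseq // -h.
Qed.

End Arrays.

Ltac run := (eapply wp_block; [reflexivity | rewrite /=; lia |
  rewrite /iset /rset /iget /rget /=]).

(* Cells of the index memory: 0 holds n, 1 the constant 1, 2 the width of the
   sorted blocks, 3 and 5 read pointers, 4 and 6 the ends of the two blocks
   being merged, 7 the write pointer, 8 its final value.  Real cells 0 to n - 1
   hold the array and n to 2n - 1 the output buffer.  Every fixed real cell may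
   belong to the input, so real registers are reached indirectly: cells 10 to 14
   hold the addresses 2n, ..., 2n + 4 of a suffix sum, a counter, M, the running
   sum c (the constant 1 while M is computed) and - M (scratch before). *)
Section Programs.
Context {R : realType}.
Implicit Types (Q : nat -> state R -> Prop) (s A d : seq R) (t n w : nat).

(** Cell 3 is the write pointer here and cell 7 the read pointer, the reverse of their roles in
    merging. *)
Definition copy_back : cmd :=
  Seq (block [:: ISet (Dir 3) 0; IMov (Dir 7) (Dir 0)])
    (While (ILt (Dir 3) (Dir 0))
      (block [:: RMov (Ind 3) (Ind 7); IAdd (Dir 3) (Dir 3) (Dir 1);
                 IAdd (Dir 7) (Dir 7) (Dir 1)])).

Lemma wp_copy_back Q t im rm n w s :
  size s = n -> im 0%N = n -> im 1%N = 1%N -> im 2%N = w -> stored rm n s ->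
  (5 * n + 5 <= t)%N ->
  (forall t' im' rm', im' 0%N = n -> im' 1%N = 1%N -> im' 2%N = w ->
     stored rm' 0 s -> (t <= t' + 5 * n + 5)%N -> Q t' (State im' rm')) ->
  wp copy_back Q t (State im rm).
Proof.
move=> sn h0 h1 h2 hs ht HQ; apply: wp_seq; run.
apply: (@wp_while _ (fun t' st => exists p, [/\
  [/\ imem st 0 = n, imem st 1 = 1, imem st 2 = w & (p <= n)]%N,
  [/\ imem st 3 = p & imem st 7 = n + p]%N,
  stored (rmem st) n s, stored (rmem st) 0 (take p s)
  & (t <= t' + 5 * p + 3)%N])).
- by move=> t' st [p [[_ _ _ pn] _ _ _ ?]]; lia.
- move=> t' [im' rm'] [p /= [[e0 e1 e2 pn] [e3 e7] hn h0' ht']].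
  rewrite /iget /= e3 e0 => {}pn; run; last first.
    exists p.+1; rewrite /= !e0 !e1 !e2 e3 e7; split=> //=; last by lia.
    - by split; lia.
    - by apply: stored_set hn _; rewrite pn.
    rewrite (take_nth 0); last by rewrite sn.
    rewrite hn ?sn //; apply: stored_rcons h0' _.
    by rewrite size_takel // sn ltnW.
- move=> t' [im' rm'] [p /= [[e0 e1 e2 pn] [e3 e7] hn h0' ht']].
  rewrite /iget /= e3 e0 -leqNgt => np; apply: HQ => //; last by lia.
  by rewrite take_oversize in h0' => //; rewrite sn.
exists 0%N; rewrite /= h0 h1 h2 addn0 take0; split=> //; lia.
Qed.

(** * Bottom-up merge sort *)

(** The blocks are aligned at multiples of [w]; the last one may be shorter, and those past the end
    are empty. *)
Definition blockwise_sorted w s : Prop :=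
  forall k, sorted <=%R (take w (drop (k * w) s)).

Definition segment i j s := take (j - i) (drop i s).

Lemma segment_cons i j s : (i < j)%N -> (j <= size s)%N ->
  segment i j s = nth 0 s i :: segment i.+1 j s.
Proof.
move=> ij js; rewrite /segment -subnSK // (drop_nth 0) //; exact: leq_trans js.
Qed.

Lemma segment_nil i s : segment i i s = [::].
Proof. by rewrite /segment subnn take0. Qed.

Lemma size_segment i j s : (j <= size s)%N -> size (segment i j s) = (j - i)%N.
Proof. by move=> js; rewrite size_takel // size_drop leq_sub2r. Qed.

Lemma take_segment i j s : (i <= j)%N -> take j s = take i s ++ segment i j s.
Proof. by move=> ij; rewrite -takeD subnKC. Qed.

Lemma merge_consl (x : R) l r : (if r is y :: _ then x <= y else true) ->
  merge <=%R (x :: l) r = x :: merge <=%R l r.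
Proof. by case: r => [|y r /= ->] //; case: l. Qed.

Lemma merge_consr (y : R) l r : (if l is x :: _ then ~~ (x <= y) else true) ->
  merge <=%R l (y :: r) = y :: merge <=%R l r.
Proof. by case: l => [|x l /= /negbTE ->]. Qed.

Definition merge_loop : cmd :=
  let takel := block [:: RMov (Ind 7) (Ind 3); IAdd (Dir 3) (Dir 3) (Dir 1);
                         IAdd (Dir 7) (Dir 7) (Dir 1)] in
  let taker := block [:: RMov (Ind 7) (Ind 5); IAdd (Dir 5) (Dir 5) (Dir 1);
                         IAdd (Dir 7) (Dir 7) (Dir 1)] in
  While (ILt (Dir 7) (Dir 8))
    (If (ILt (Dir 3) (Dir 4))
       (If (ILt (Dir 5) (Dir 6)) (If (RLe (Ind 3) (Ind 5)) takel taker) takel)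
       taker).

(** The list [d] is the output of the earlier merges of the same pass. Each output element costs at
    most 8 units: the loop test, three conditionals and a block of three instructions. *)
Lemma wp_merge_loop Q t im rm n w s d m e : let i := size d in
  [/\ size s = n, i <= m, m <= e & e <= n]%N ->
  [/\ im 0 = n, im 1 = 1, im 2 = w & im 8 = n + e]%N ->
  [/\ im 3 = i, im 4 = m, im 5 = m, im 6 = e & im 7 = n + i]%N ->
  stored rm 0 s -> stored rm n d -> (8 * (e - i) < t)%N ->
  (forall t' im' rm',
     [/\ im' 0 = n, im' 1 = 1, im' 2 = w, im' 6 = e & im' 7 = n + e]%N ->
     stored rm' 0 s ->
     stored rm' n (d ++ merge <=%R (segment i m s) (segment m e s)) ->
     (t <= t' + 8 * (e - i) + 1)%N -> Q t' (State im' rm')) ->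
  wp merge_loop Q t (State im rm).
Proof.
move=> i0 [sn i0m me en] [h0 h1 h2 h8] [h3 h4 h5 h6 h7] hs hd ht HQ.
(* The output so far followed by the merge of what is left of both blocks never changes. The size
   equation shows that the output ends at [e] exactly when both blocks are exhausted. *)
pose I t' (st : state R) := exists i j out, [/\
  [/\ [/\ imem st 0 = n, imem st 1 = 1, imem st 2 = w & imem st 8 = n + e],
      [/\ imem st 3 = i, imem st 4 = m, imem st 5 = j, imem st 6 = e
        & imem st 7 = n + size out],
      [/\ i <= m, m <= j & j <= e]
    & size out + (m - i) + (e - j) = e]%N,
  out ++ merge <=%R (segment i m s) (segment j e s)
    = d ++ merge <=%R (segment i0 m s) (segment m e s),
  stored (rmem st) 0 s, stored (rmem st) n out
  & (t + 8 * i0 <= t' + 8 * size out)%N].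
apply: (@wp_while _ I).
- by move=> t' st [i [j [out [[_ _ _ ?] _ _ _ ?]]]]; lia.
- move=> t' [im' rm'] [i [j [out [/= [[e0 e1 e2 e8] [e3 e4 e5 e6 e7]
      [im_ mj je] sz] eq_out st_s st_out ht']]]].
  rewrite /iget /= e7 e8 ltn_add2l => out_e.
  (* The copying blocks are reached after different numbers of tests, at most four, hence the
     separate budget [t1]. *)
  have takel t1 : (t' <= t1 + 4)%N -> (i < m)%N ->
      (if segment j e s is y :: _ then nth 0 s i <= y else true) ->
      wp (block [:: RMov (Ind 7) (Ind 3); IAdd (Dir 3) (Dir 3) (Dir 1);
                    IAdd (Dir 7) (Dir 7) (Dir 1)]) I t1 (State im' rm').
    move=> ht1 i_m hle; run.
    exists i.+1, j, (rcons out (nth 0 s i)).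
    rewrite /= !e0 !e1 !e2 !e3 !e4 !e5 !e6 !e7 !e8 size_rcons; split.
    + by split; [|split; lia|split; lia|lia].
    + rewrite -eq_out (@segment_cons i) //; last by lia.
      by rewrite merge_consl // cat_rcons.
    + by apply: stored_set => //; rewrite sn leq_addr orbT.
    + by rewrite -{1}(add0n i) st_s; [exact: stored_rcons|lia].
    + lia.
  have taker t1 : (t' <= t1 + 4)%N -> (j < e)%N ->
      (if segment i m s is x :: _ then ~~ (x <= nth 0 s j) else true) ->
      wp (block [:: RMov (Ind 7) (Ind 5); IAdd (Dir 5) (Dir 5) (Dir 1);
                    IAdd (Dir 7) (Dir 7) (Dir 1)]) I t1 (State im' rm').
    move=> ht1 j_e hle; run.
    exists i, j.+1, (rcons out (nth 0 s j)).
    rewrite /= !e0 !e1 !e2 !e3 !e4 !e5 !e6 !e7 !e8 size_rcons; split.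
    + by split; [|split; lia|split; lia|lia].
    + rewrite -eq_out (@segment_cons j) //; last by lia.
      by rewrite merge_consr // cat_rcons.
    + by apply: stored_set => //; rewrite sn leq_addr orbT.
    + by rewrite -{1}(add0n j) st_s; [exact: stored_rcons|lia].
    + lia.
  apply: wp_if; first by lia.
    rewrite /= /iget /= e3 e4 => i_m; apply: wp_if; first by lia.
      rewrite /= /iget /= e5 e6 => j_e; apply: wp_if; first by lia.
        rewrite /= /rget /= e3 e5 -{1}(add0n i) -{1}(add0n j).
        rewrite !st_s ?sn //; try lia.
        move=> ij; apply: takel => //; first by lia.
        by rewrite segment_cons // sn; lia.
      rewrite /= /rget /= e3 e5 -{1}(add0n i) -{1}(add0n j).
      rewrite !st_s ?sn //; try lia.
      move=> ij; apply: taker => //; first by lia.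
      by rewrite segment_cons // sn; lia.
    rewrite /= /iget /= e5 e6 -leqNgt => e_j; apply: takel => //; first by lia.
    by have -> : j = e; [lia|rewrite segment_nil].
  rewrite /= /iget /= e3 e4 -leqNgt => m_i; apply: taker; [lia|lia|].
  by have -> : i = m; [lia|rewrite segment_nil].
- move=> t' [im' rm'] [i [j [out [/= [[e0 e1 e2 e8] [e3 e4 e5 e6 e7]
      [im_ mj je] sz] eq_out st_s st_out ht']]]].
  rewrite /iget /= e7 e8 ltn_add2l => out_e.
  have [i_m j_e] : i = m /\ j = e by lia.
  apply: HQ => //; last by lia.
    by rewrite e0 e1 e2 e6 e7; split=> //; lia.
  by move: eq_out; rewrite i_m j_e !segment_nil cats0 => <-.
exists i0, m, d; rewrite /= h0 h1 h2 h3 h4 h5 h6 h7 h8.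
by split=> //; split=> //; lia.
Qed.

(** Both block ends are clipped to [n], so that a short or missing block at the end of the array
    needs no separate treatment. *)
Definition merge_pass : cmd :=
  Seq (block [:: ISet (Dir 3) 0; IMov (Dir 7) (Dir 0)])
    (While (ILt (Dir 3) (Dir 0))
      (Seq (block [:: IAdd (Dir 4) (Dir 3) (Dir 2)])
      (Seq (If (ILt (Dir 0) (Dir 4)) (Do (IMov (Dir 4) (Dir 0))) Skip)
      (Seq (block [:: IMov (Dir 5) (Dir 4); IAdd (Dir 6) (Dir 4) (Dir 2)])
      (Seq (If (ILt (Dir 0) (Dir 6)) (Do (IMov (Dir 6) (Dir 0))) Skip)
      (Seq (block [:: IAdd (Dir 8) (Dir 0) (Dir 6)])
      (Seq merge_loop (Do (IMov (Dir 3) (Dir 6)))))))))).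

Lemma wp_clip k Q t im rm :
  (2 <= t)%N ->
  (forall im', im' k = minn (im k) (im 0%N) ->
     (forall l, l != k -> im' l = im l) -> Q (t - 2)%N (State im' rm)) ->
  wp (If (ILt (Dir 0) (Dir k)) (Do (IMov (Dir k) (Dir 0))) Skip) Q t
    (State im rm).
Proof.
move=> t2 HQ; have t_2 : (t - 2 = t.-2)%N by lia.
rewrite t_2 in HQ; apply: wp_if; first by lia.
  rewrite /= /iget /= => lt; apply: wp_do; [reflexivity|lia|].
  rewrite /iset /iget /=; apply: HQ => [|l /negbTE lk] /=; last by rewrite lk.
  by rewrite eqxx; lia.
rewrite /= /iget /= -leqNgt => le; apply: wp_skip; first by lia.
by apply: HQ => //; lia.
Qed.

(** The list [d] consists of [q] full double blocks and the merge forms the next one. A block with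
    index below [q] lies inside [d], one with index above [q] is empty, and block [q] is the
    merge. *)
Lemma blockwise_sorted_merge w s d i q : (0 < w)%N ->
  i = (q * (w + w))%N -> (i < size s)%N -> size d = i ->
  blockwise_sorted w s -> blockwise_sorted (w + w) d ->
  let m := minn (i + w) (size s) in let e := minn (m + w) (size s) in
  blockwise_sorted (w + w) (d ++ merge <=%R (segment i m s) (segment m e s)).
Proof.
move=> w0 iq i_s sd bs bd m e k.
have total_le : total (<=%R : rel R) by move=> x y; apply: le_total.
have [kq|qk|->] := ltngtP k q.
- have kd : (k * (w + w) + (w + w) <= i)%N.
    by rewrite iq -mulSnr leq_mul2r kq orbT.
  rewrite drop_cat sd ifT; last by lia.
  rewrite take_cat size_drop sd; case: ltnP => // h; last first.
    have -> : (w + w - (i - k * (w + w)) = 0)%N by lia.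
    rewrite take0 cats0; have := bd k; rewrite take_oversize //.
    by rewrite size_drop sd; lia.
- have kd : (i + (w + w) <= k * (w + w))%N.
    by rewrite iq -mulSnr leq_mul2r qk orbT.
  rewrite drop_oversize // size_cat sd size_merge size_cat !size_segment; lia.
rewrite -iq drop_size_cat // take_oversize; last first.
  by rewrite size_merge size_cat !size_segment; lia.
apply: merge_sorted => //.
  (* The two halves of double block [q] are the blocks [2q] and [2q + 1] of [s]. *)
  have := bs (q + q)%N; rewrite mulnDl -mulnDr -iq /segment.
  have [h|h] := boolP (i + w <= size s)%N.
    by have -> : (m - i = w)%N by lia.
  by rewrite !take_oversize // size_drop; lia.
rewrite /segment; have [h|h] := boolP (size s <= i + w)%N.
  by rewrite drop_oversize //; lia.
have := bs (q + q).+1; rewrite mulSn mulnDl -mulnDr -iq addnC.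
have -> : (m = i + w)%N by lia.
have [h'|h'] := boolP (i + w + w <= size s)%N.
  by have -> : (e - (i + w) = w)%N by lia.
by rewrite !take_oversize // size_drop; lia.
Qed.

(** Every iteration outputs at least one element. The 25 units per element cover the 8 of the inner
    loop and leave 17 for the constant overhead of the iteration. *)
Lemma wp_merge_pass Q t im rm n w s :
  size s = n -> (0 < w)%N -> [/\ im 0 = n, im 1 = 1 & im 2 = w]%N ->
  stored rm 0 s -> blockwise_sorted w s -> (25 * n + 5 <= t)%N ->
  (forall t' im' rm' d, [/\ im' 0 = n, im' 1 = 1 & im' 2 = w]%N ->
     perm_eq d s -> blockwise_sorted (w + w) d -> stored rm' n d ->
     (t <= t' + 25 * n + 5)%N -> Q t' (State im' rm')) ->
  wp merge_pass Q t (State im rm).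
Proof.
move=> sn w0 [h0 h1 h2] hs bs ht HQ; apply: wp_seq; run.
apply: (@wp_while _ (fun t' st => exists q d,
  [/\ [/\ imem st 0 = n, imem st 1 = 1, imem st 2 = w, imem st 3 = size d
        & imem st 7 = n + size d]%N,
    size d = minn (q * (w + w)) n, perm_eq d (take (size d) s)
      /\ blockwise_sorted (w + w) d,
    stored (rmem st) 0 s /\ stored (rmem st) n d
    & (t <= t' + 25 * size d + 4)%N])).
- by move=> t' st [q [d [[? ? ? ? ?] sd _ _ ?]]]; lia.
- move=> t' [im' rm'] [q [d [/= [e0 e1 e2 e3 e7] sd [pd bd] [st_s st_d] ht']]].
  rewrite /iget /= e0 e3 => {}dn.
  (* Only the last double block can be cut short by [n], so before the loop ends [d] consists of
     full ones. *)
  have {}sd : size d = (q * (w + w))%N by lia.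
  set i := size d in sd dn e3 e7 ht' pd *.
  apply: wp_seq; run; rewrite e3 e2.
  apply: wp_seq; apply: wp_clip => [|im1 /= g4 g]; first by rewrite /=; lia.
  rewrite e0 in g4.
  have g0 : im1 0%N = n by rewrite g.
  have g1 : im1 1%N = 1%N by rewrite g.
  have g2 : im1 2%N = w by rewrite g.
  have g3 : im1 3%N = i by rewrite g.
  have g7 : im1 7%N = (n + i)%N by rewrite g.
  apply: wp_seq; run; rewrite g4 g2.
  apply: wp_seq; apply: wp_clip => [|im2 /= k6 k]; first by rewrite /=; lia.
  rewrite g0 in k6.
  have k0 : im2 0%N = n by rewrite k.
  have k1 : im2 1%N = 1%N by rewrite k.
  have k2 : im2 2%N = w by rewrite k.
  have k3 : im2 3%N = i by rewrite k.
  have k4 : im2 4%N = minn (i + w) n by rewrite k.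
  have k5 : im2 5%N = minn (i + w) n by rewrite k.
  have k7 : im2 7%N = (n + i)%N by rewrite k.
  apply: wp_seq; run; rewrite k0 k6.
  set m := minn (i + w) n in k4 k5 k6 *.
  set e := minn (m + w) n in k6 *.
  apply: wp_seq; apply: (@wp_merge_loop _ _ _ _ n w s d m e) => //.
  + by split=> //; lia.
  + rewrite -/i; have : (e <= n)%N by rewrite geq_minr.
    clear -ht ht' dn; lia.
  move=> t1 im3 rm3 [l0 l1 l2 l6 l7] st_s3 st_d3 ht1.
  apply: wp_do; [reflexivity|lia|]; rewrite /iset /iget /=.
  set d' := d ++ _ in st_d3 *.
  have sd' : size d' = e.
    by rewrite size_cat size_merge size_cat !size_segment; lia.
  exists q.+1, d'; rewrite /= l0 l1 l2 l6 l7 sd'; split=> //.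
  + by rewrite mulSn -sd; lia.
  + split; last first.
      by rewrite /d' /e /m -sn; apply: (blockwise_sorted_merge w0 sd) => //; lia.
    have [im_ me] : (i <= m)%N /\ (m <= e)%N by lia.
    rewrite (take_segment _ me) (take_segment _ im_) -catA.
    by rewrite perm_cat // perm_merge.
  + by lia.
- move=> t' [im' rm'] [q [d [/= [e0 e1 e2 e3 e7] sd [pd bd] [st_s st_d] ht']]].
  rewrite /iget /= e0 e3 -leqNgt => nd; have {}sd : size d = n by lia.
  apply: (HQ _ _ _ d) => //; last by lia.
  by move: pd; rewrite take_oversize // sn sd.
exists 0%N, [::]; rewrite /= h0 h1 h2 addn0 take0; split=> //; first by lia.
by lia.
Qed.

Definition merge_sort : cmd :=
  Seq (block [:: ISet (Dir 1) 1; ISet (Dir 2) 1])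
    (While (ILt (Dir 2) (Dir 0))
      (Seq merge_pass (Seq copy_back (Do (IAdd (Dir 2) (Dir 2) (Dir 2)))))).

(** After [k] passes the blocks have width [2 ^ k], so [up_log 2 n] passes suffice. Each one,
    copying back included, costs at most [40 * n.+1]. *)
Lemma wp_merge_sort Q t im rm n A :
  size A = n -> im 0%N = n -> stored rm 0 A ->
  (40 * n.+1 * up_log 2 n + 5 <= t)%N ->
  (forall t' im' rm', [/\ im' 0 = n & im' 1 = 1]%N ->
     stored rm' 0 (sort <=%R A) ->
     (t <= t' + 40 * n.+1 * up_log 2 n + 5)%N -> Q t' (State im' rm')) ->
  wp merge_sort Q t (State im rm).
Proof.
move=> sA h0 hA ht HQ; apply: wp_seq; run.
apply: (@wp_while _ (fun t' st => exists k s,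
  [/\ [/\ imem st 0 = n, imem st 1 = 1 & imem st 2 = 2 ^ k]%N,
    perm_eq s A, blockwise_sorted (2 ^ k) s, stored (rmem st) 0 s
    & (40 * n.+1 * (up_log 2 n - k) + 1 <= t' /\
       t <= t' + 40 * n.+1 * k + 4 /\ k <= up_log 2 n)%N])).
- by move=> t' st [k [s [_ _ _ _ [h _]]]]; apply: leq_trans h; rewrite addn1.
- move=> t' [im' rm'] [k [s [/= [e0 e1 e2] sA' bs st_s [ht1 [ht2 _]]]]].
  rewrite /iget /= e0 e2 => kn.
  have ss : size s = n by rewrite (perm_size sA').
  have kl : (k < up_log 2 n)%N.
    rewrite ltnNge; apply/negP => /(leq_pexp2l (isT : 0 < 2)%N).
    by have := @up_logP 2 n isT; lia.
  have mk : (up_log 2 n - k = (up_log 2 n - k.+1).+1)%N by lia.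
  rewrite mk mulnSr in ht1; have P0 := leq0n (n * (up_log 2 n - k.+1)).
  apply: wp_seq; apply: (wp_merge_pass ss _ (And3 e0 e1 e2)) => //.
  + by rewrite expn_gt0.
  + by lia.
  move=> t1 im1 rm1 d [g0 g1 g2] pd bd st_d ht3.
  apply: wp_seq; apply: (wp_copy_back (n := n) (w := (2 ^ k)%N) (s := d)) => //.
  + by rewrite (perm_size pd).
  + by lia.
  move=> t2 im2 rm2 k0 k1 k2 st_d2 ht4.
  apply: wp_do; [reflexivity|lia|]; rewrite /iset /iget /=.
  exists k.+1, d; rewrite /= k0 k1 k2 expnS mul2n -addnn; split=> //.
  + exact: perm_trans sA'.
  + by rewrite mulnSr; lia.
- move=> t' [im' rm'] [k [s [/= [e0 e1 e2] sA' bs st_s [ht1 [ht2 kl]]]]].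
  rewrite /iget /= e0 e2 -leqNgt => kn; apply: HQ => //.
    (* On exit a single block covers the whole array, and a sorted permutation of [A] is unique. *)
    have -> // : sort <=%R A = s.
    apply: (sorted_eq le_trans le_anti).
    + by apply: sort_sorted => x y; apply: le_total.
    + by have := bs 0%N; rewrite mul0n drop0 take_oversize // (perm_size sA') sA.
    by rewrite perm_sort perm_sym.
  have : (40 * n.+1 * k <= 40 * n.+1 * up_log 2 n)%N by rewrite leq_mul2l kl orbT.
  lia.
exists 0%N, A; rewrite /= h0; split=> //; last by lia.
move=> k; rewrite expn0 muln1; case: (drop k A) => //= x l; by rewrite take0.
Qed.

End Programs.

(** * The bound M and the greedy loop *)

Section Balancing.
Context {R : realType}.
Implicit Types (Q : nat -> state R -> Prop) (s out A v : seq R) (t n : nat).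

Definition registers n (im : nat -> nat) : Prop :=
  [/\ im 0 = n, im 1 = 1 & [/\ im 10 = n + n + 0, im 11 = n + n + 1,
     im 12 = n + n + 2, im 13 = n + n + 3 & im 14 = n + n + 4]]%N.

Definition memory n (rm : nat -> R) s out v : Prop :=
  [/\ stored rm 0 s, stored rm n out & stored rm (n + n) v].

Lemma stored_update (rm : nat -> R) b s j x : stored rm b s -> (j < size s)%N ->
  stored [eta rm with (b + j)%N |-> x] b (set_nth 0 s j x).
Proof.
move=> h js i; rewrite size_set_nth (maxn_idPr js) => si /=.
by rewrite nth_set_nth /= eqn_add2l h.
Qed.

(** The size conditions keep the array and the buffer below cell [n + n], where the registers begin,
    so that a register update leaves both intact. *)
Lemma wp_real j x Q t im rm n s out v i :
  step i (State im rm) = Some (State im [eta rm with (n + n + j)%N |-> x]) ->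
  memory n rm s out v -> (j < size v)%N -> (size s <= n)%N -> (size out <= n)%N ->
  (0 < t)%N ->
  (forall rm', memory n rm' s out (set_nth 0 v j x) -> Q t.-1 (State im rm')) ->
  wp (Do i) Q t (State im rm).
Proof.
move=> h [m1 m2 m3] jv sn on t0 HQ; apply: wp_do h t0 _; apply: HQ; split.
- by apply: stored_set m1 _; lia.
- by apply: stored_set m2 _; lia.
- exact: stored_update.
Qed.

Lemma wp_real_max a x Q t im rm n s out S cnt M one tmp :
  registers n im -> memory n rm s out [:: S; cnt; M; one; tmp] ->
  (size s <= n)%N -> (size out <= n)%N -> rm (im a) = x -> (2 <= t)%N ->
  (forall rm', memory n rm' s out [:: S; cnt; Num.max M x; one; tmp] ->
     Q (t - 2)%N (State im rm')) ->
  wp (If (RLt (Ind 12) (Ind a)) (Do (RMov (Ind 12) (Ind a))) Skip) Q t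
    (State im rm).
Proof.
move=> [e0 e1 [e10 e11 e12 e13 e14]] mm sn on ax t2.
have -> : (t - 2 = t.-2)%N by lia.
have [_ _ mv] := mm => HQ.
apply: wp_if; rewrite /= /rget /= ?ax ?e12 ?(mv 2%N) //=; first by lia.
  move=> Mx; apply: (@wp_real 2 x _ _ _ _ n s out _ _ _ mm) => //; last 2 first.
  - by lia.
  - by move=> rm' /=; move: HQ; rewrite (max_idPr (ltW Mx)); apply.
  by rewrite /= /rset /rget /= e12 ax.
rewrite -leNgt => xM; apply: wp_skip; first by lia.
by apply: HQ; rewrite (max_idPl xM).
Qed.

(** The first loop computes the total; the second subtracts the elements from the front, so that
    each suffix sum is available in constant time. The counter is incremented before the division,
    which therefore never fails. *)
Definition compute_bound : cmd :=
  Seq (block [:: IAdd (Dir 10) (Dir 0) (Dir 0); IAdd (Dir 11) (Dir 10) (Dir 1);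
                 IAdd (Dir 12) (Dir 11) (Dir 1); IAdd (Dir 13) (Dir 12) (Dir 1);
                 IAdd (Dir 14) (Dir 13) (Dir 1); ISet (Dir 3) 0])
  (Seq (Do (RSet (Ind 10) 0))
  (Seq (While (ILt (Dir 3) (Dir 0))
         (Seq (Do (RAdd (Ind 10) (Ind 10) (Ind 3)))
              (Do (IAdd (Dir 3) (Dir 3) (Dir 1)))))
  (Seq (Do (ISet (Dir 3) 0))
  (Seq (Do (RSet (Ind 11) 0))
  (Seq (Do (RSet (Ind 12) 0))
  (Seq (Do (RSet (Ind 13) 1))
    (While (ILt (Dir 3) (Dir 0))
      (Seq (Do (RAdd (Ind 11) (Ind 11) (Ind 13)))
      (Seq (Do (RDiv (Ind 14) (Ind 10) (Ind 11)))
      (Seq (If (RLt (Ind 12) (Ind 14)) (Do (RMov (Ind 12) (Ind 14))) Skip)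
      (Seq (If (RLt (Ind 12) (Ind 3)) (Do (RMov (Ind 12) (Ind 3))) Skip)
      (Seq (Do (RSub (Ind 10) (Ind 10) (Ind 3)))
           (Do (IAdd (Dir 3) (Dir 3) (Dir 1))))))))))))))).

Lemma wp_compute_bound Q t im rm n s :
  size s = n -> im 0%N = n -> im 1%N = 1%N -> stored rm 0 s ->
  (20 * n + 20 <= t)%N ->
  (forall t' im' rm' (x0 x1 x3 x4 : R), registers n im' ->
     memory n rm' s [::] [:: x0; x1; bound s n; x3; x4] ->
     (t <= t' + 20 * n + 20)%N -> Q t' (State im' rm')) ->
  wp compute_bound Q t (State im rm).
Proof.
move=> sn h0 h1 hs ht HQ; apply: wp_seq; run.
set im1 := [eta _ with _ |-> _].
have reg1 : registers n im1.
  by rewrite /registers /= !h0 !h1; split=> //; split; lia.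
have i3 : im1 3%N = 0%N by [].
move: im1 reg1 i3 => {h0 h1}im1 reg1 i3.
(* The initial contents of the registers are arbitrary and are simply given names. *)
have mem1 : memory n rm s [::] (mkseq (fun j => rm (n + n + j)%N) 5).
  by split=> // i; rewrite size_mkseq => i5; rewrite nth_mkseq.
have [e0 e1 [e10 e11 e12 e13 e14]] := reg1.
have sn' : (size s <= n)%N by rewrite sn.
apply: wp_seq.
apply: (@wp_real 0 0 _ _ _ _ n s _ _ _ _ mem1) => //.
- by rewrite /= /rset /= e10.
- by lia.
move=> {hs mem1} rm1 /= mem1.
move: (rm (n + n + 1)%N) (rm (n + n + 2)%N) (rm (n + n + 3)%N)
  (rm (n + n + 4)%N) mem1 => w1 w2 w3 w4 {rm} mem1.
apply: wp_seq; apply: (@wp_while _ (fun t' st => exists p,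
  [/\ registers n (imem st), imem st 3 = p, (p <= n)%N,
    memory n (rmem st) s [::] [:: score (take p s); w1; w2; w3; w4]
  & (t <= t' + 10 * p + 10)%N])).
- by move=> t' st [p [_ _ ? _ ?]]; lia.
- move=> t' [im2 rm2] [p [/= reg2 i3' _ mem2 ht']].
  have [f0 f1 [f10 f11 f12 f13 f14]] := reg2.
  have [ms _ mv] := mem2.
  rewrite /iget /= f0 i3' => pn.
  have ps : rm2 p = nth 0 s p by rewrite -ms // sn.
  apply: wp_seq.
  apply: (@wp_real 0 (score (take p.+1 s)) _ _ _ _ n s _ _ _ _ mem2) => //.
  + rewrite /= /rset /rget /= f10 i3' (mv 0%N) //= ps.
    by rewrite (take_nth 0) ?sn // -cats1 score_cat /score big_seq1.
  + by lia.
  move=> rm3 /= mem3; apply: wp_do; [reflexivity|lia|].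
  exists p.+1; rewrite /iset /iget /= i3' f1 addn1; split=> //; last by lia.
- move=> t' [im2 rm2] [p [/= reg2 i3' pn mem2 ht']].
  have [f0 f1 [f10 f11 f12 f13 f14]] := reg2.
  rewrite /iget /= f0 i3' -leqNgt => np.
  have {np} pE : p = n by lia.
  rewrite pE take_oversize ?sn // in mem2 i3' ht' *.
  apply: wp_seq; apply: wp_do; [reflexivity|lia|].
  rewrite /iset /=; set im3 := [eta _ with _ |-> _].
  have reg3 : registers n im3 by rewrite /registers /im3 /=.
  have {i3'} i3' : im3 3%N = 0%N by [].
  move: im3 reg3 i3' => {im2 reg2 f0 f1 f10 f11 f12 f13 f14} im2 reg2 i3'.
  have [f0 f1 [f10 f11 f12 f13 f14]] := reg2.
  apply: wp_seq.
  apply: (@wp_real 1 0 _ _ _ _ n s _ _ _ _ mem2) => //.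
  + by rewrite /= /rset /= f11.
  + by lia.
  move=> {mem2} rm3 /= mem2.
  apply: wp_seq.
  apply: (@wp_real 2 0 _ _ _ _ n s _ _ _ _ mem2) => //.
  + by rewrite /= /rset /= f12.
  + by lia.
  move=> {mem2} rm4 /= mem2.
  apply: wp_seq.
  apply: (@wp_real 3 1 _ _ _ _ n s _ _ _ _ mem2) => //.
  + by rewrite /= /rset /= f13.
  + by lia.
  move=> {mem2} rm5 /= mem2.
  apply: (@wp_while _ (fun t' st => exists p w,
    [/\ registers n (imem st), imem st 3 = p, (p <= n)%N,
      memory n (rmem st) s [::] [:: score (drop p s); p%:R; bound s p; 1; w]
    & (t <= t' + 10 * n + 10 * p + 15)%N])).
  + by move=> t1 st [q [w [_ _ ? _ ?]]]; lia.
  + move=> t1 [im6 rm6] [q [w [/= reg6 i6 qn mem6 ht6]]].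
    have [g0 g1 [g10 g11 g12 g13 g14]] := reg6.
    rewrite /iget /= g0 i6 => {}qn.
    have sE : score (drop q s) = nth 0 s q + score (drop q.+1 s).
      by rewrite (drop_nth 0) ?sn // score_cons.
    apply: wp_seq.
    apply: (@wp_real 1 q.+1%:R _ _ _ _ n s _ _ _ _ mem6) => //.
    * have [_ _ mv] := mem6.
      by rewrite /= /rset /rget /= g11 g13 (mv 1%N) // (mv 3%N) //= natr1.
    * by lia.
    move=> {mem6} rm7 /= mem6.
    apply: wp_seq.
    apply: (@wp_real 4 (score (drop q s) / q.+1%:R) _ _ _ _ n s _ _ _ _ mem6) => //.
    * have [_ _ mv] := mem6.
      rewrite /= /rset /rget /= g14 g10 g11 (mv 1%N) // (mv 0%N) //= ifN //.
    * by lia.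
    move=> {mem6} rm8 /= mem6.
    (* The two updates follow the nesting of the maxima in [bound]: first the quotient, then the
       element. *)
    apply: wp_seq.
    apply: (@wp_real_max _ (score (drop q s) / q.+1%:R) _ _ _ _ _ _ _ _ _ _ _ _ reg6 mem6)
      => //.
    * by have [_ _ mv] := mem6; rewrite g14 (mv 4%N).
    * by lia.
    move=> {mem6} rm9 /= mem6.
    apply: wp_seq.
    apply: (@wp_real_max _ (nth 0 s q) _ _ _ _ _ _ _ _ _ _ _ _ reg6 mem6)
      => //.
    * by rewrite i6; have [ms _ _] := mem6; rewrite -ms // sn.
    * by lia.
    move=> {mem6} rm10 /= mem6.
    apply: wp_seq.
    apply: (@wp_real 0 (score (drop q.+1 s)) _ _ _ _ n s _ _ _ _ mem6) => //.
    * have [ms _ mv] := mem6.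
      rewrite /= /rset /rget /= g10 i6 (mv 0%N) //= -{1}(add0n q) ms ?sn //.
      by rewrite sE addrC addKr.
    * by lia.
    move=> {mem6} rm11 /= mem6; apply: wp_do; [reflexivity|lia|].
    exists q.+1, (score (drop q s) / q.+1%:R).
    by rewrite /iset /iget /= i6 g1 addn1; split=> //; lia.
  + move=> t1 [im6 rm6] [q [w [/= reg6 i6 qn mem6 ht6]]].
    have [g0 _ _] := reg6.
    rewrite /iget /= g0 i6 -leqNgt => nq; have qE : q = n by lia.
    rewrite qE in mem6 ht6; apply: HQ reg6 mem6 _; lia.
  by exists 0%N, w4; rewrite /= drop0; split=> //; lia.
by exists 0%N; rewrite take0 score_nil; split=> //=; lia.
Qed.

(** The remaining elements form a segment of the sorted array delimited by cells 3 and 4, so both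
    the largest and the smallest are found in constant time; cell 5 points to the chosen one. [- M]
    is obtained by subtraction from 0. *)
Definition greedy_loop : cmd :=
  Seq (block [:: ISet (Dir 3) 0; IMov (Dir 4) (Dir 0); IMov (Dir 7) (Dir 0)])
  (Seq (Do (RSet (Ind 13) 0))
  (Seq (Do (RSet (Ind 14) 0))
  (Seq (Do (RSub (Ind 14) (Ind 14) (Ind 12)))
    (While (ILt (Dir 3) (Dir 4))
      (Seq (If (RLe (Ind 13) (Ind 12))
              (block [:: ISub (Dir 4) (Dir 4) (Dir 1); IMov (Dir 5) (Dir 4)])
              (block [:: IMov (Dir 5) (Dir 3); IAdd (Dir 3) (Dir 3) (Dir 1)]))
      (Seq (Do (RMov (Ind 7) (Ind 5)))
      (Seq (Do (IAdd (Dir 7) (Dir 7) (Dir 1)))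
           (If (RLt (Ind 5) (Ind 14))
              (Do (RAdd (Ind 13) (Ind 13) (Ind 14)))
              (Do (RAdd (Ind 13) (Ind 13) (Ind 5))))))))))).

Lemma segment_last (x : R) i j s : (i < j)%N -> (j <= size s)%N ->
  last x (segment i j s) = nth 0 s j.-1.
Proof.
case: j => // j; rewrite ltnS => ij js.
rewrite (last_nth 0) size_segment // subSn //= nth_take; last by lia.
by rewrite nth_drop subnKC.
Qed.

Lemma segment_belast i j s : (j <= size s)%N ->
  take (size (segment i j s)).-1 (segment i j s) = segment i j.-1 s.
Proof.
by move=> js; rewrite size_segment // /segment take_takel; [congr take|]; lia.
Qed.

Lemma wp_greedy_loop Q t im rm n s M (x0 x1 x3 x4 : R) :
  size s = n -> registers n im -> memory n rm s [::] [:: x0; x1; M; x3; x4] ->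
  (15 * n + 10 <= t)%N ->
  (forall t' im' rm', registers n im' ->
     stored rm' n (greedy M 0 s n) -> (t <= t' + 15 * n + 10)%N ->
     Q t' (State im' rm')) ->
  wp greedy_loop Q t (State im rm).
Proof.
move=> sn [h0 h1 [h10 h11 h12 h13 h14]] mem1 ht HQ; apply: wp_seq; run.
set im1 := [eta _ with _ |-> _].
have reg1 : registers n im1 by rewrite /registers /=.
have i3 : im1 3%N = 0%N by [].
have i4 : im1 4%N = n by [].
have i7 : im1 7%N = n by [].
move: im1 reg1 i3 i4 i7 => {im h0 h1 h10 h11 h12 h13 h14} im reg1 i3 i4 i7.
have [h0 h1 [h10 h11 h12 h13 h14]] := reg1.
have sn' : (size s <= n)%N by rewrite sn.
apply: wp_seq.
apply: (@wp_real 3 0 _ _ _ _ n s _ _ _ _ mem1) => //.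
- by rewrite /= /rset /= h13.
- by lia.
move=> {mem1} rm1 /= mem1.
apply: wp_seq.
apply: (@wp_real 4 0 _ _ _ _ n s _ _ _ _ mem1) => //.
- by rewrite /= /rset /= h14.
- by lia.
move=> {mem1} rm2 /= mem1.
apply: wp_seq.
apply: (@wp_real 4 (- M) _ _ _ _ n s _ _ _ _ mem1) => //.
- have [_ _ mv] := mem1.
  by rewrite /= /rset /rget /= h14 h12 (mv 4%N) // (mv 2%N) //= sub0r.
- by lia.
move=> {mem1} rm3 /= mem1.
(* The output so far, continued by the greedy run on the remaining segment from the current sum [c],
   is always the complete greedy output. *)
pose I t' (st : state R) := exists lo hi c out, [/\
    registers n (imem st),
    [/\ imem st 3 = lo, imem st 4 = hi & imem st 7 = n + size out]%N,
    [/\ lo <= hi, hi <= n & size out + (hi - lo) = n]%N,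
    out ++ greedy M c (segment lo hi s) (hi - lo) = greedy M 0 s n
  & memory n (rmem st) s out [:: x0; x1; M; c; - M] /\
    (t <= t' + 15 * size out + 9)%N].
apply: (@wp_while _ I).
- by move=> t' st [lo [hi [c [out [_ _ [_ _ ?] _ [_ ?]]]]]]; lia.
- move=> t' [im2 rm4] [lo [hi [c [out /=
    [reg2 [j3 j4 j7] [lohi hin so] eq_out [mem2 ht']]]]]].
  have [e0 e1 [e10 e11 e12 e13 e14]] := reg2.
  rewrite /iget /= j3 j4 => {}lohi.
  have [ms _ mv] := mem2.
  have hk : (hi - lo = (hi - lo.+1).+1)%N by lia.
  rewrite hk /= in eq_out.
  pose p := if c <= M then hi.-1 else lo.
  have pn : (p < n)%N by rewrite /p; case: ifP => _; lia.
  pose lo' := if c <= M then lo else lo.+1.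
  pose hi' := if c <= M then hi.-1 else hi.
  have [lohi' hin' so' hk2] : [/\ lo' <= hi', hi' <= n,
      (size out).+1 + (hi' - lo') = n & hi' - lo' = hi - lo.+1]%N.
    by rewrite /lo' /hi'; case: ifP => _; split; lia.
  have eq_out' : rcons out (nth 0 s p) ++
      greedy M (c + Num.max (nth 0 s p) (- M)) (segment lo' hi' s) (hi' - lo')
      = greedy M 0 s n.
    rewrite cat_rcons -eq_out hk2 /p /lo' /hi'; case: ifP => _.
      by rewrite segment_last ?segment_belast ?sn.
    by rewrite (segment_cons lohi) ?sn.
  apply: wp_seq.
  (* The rest of the loop body is the same for both choices and depends only on the position [p] and
     the new ends [lo'] and [hi']. *)
  have next im3 t1 : registers n im3 -> im3 3%N = lo' -> im3 4%N = hi' ->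
      im3 5%N = p -> im3 7%N = (n + size out)%N -> (t' <= t1 + 6)%N ->
      wp (Seq (Do (RMov (Ind 7) (Ind 5)))
         (Seq (Do (IAdd (Dir 7) (Dir 7) (Dir 1)))
              (If (RLt (Ind 5) (Ind 14))
                 (Do (RAdd (Ind 13) (Ind 13) (Ind 14)))
                 (Do (RAdd (Ind 13) (Ind 13) (Ind 5)))))) I t1 (State im3 rm4).
    move=> reg3 k3 k4 k5 k7 ht1.
    have [g0 g1 [g10 g11 g12 g13 g14]] := reg3.
    apply: wp_seq; apply: wp_do; [reflexivity|lia|].
    rewrite /rset /rget /= k7 k5 -{1}(add0n p) ms ?sn //.
    set rm5 := [eta _ with _ |-> _].
    have mem3 : memory n rm5 s (rcons out (nth 0 s p)) [:: x0; x1; M; c; - M].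
      have [_ mo _] := mem2.
      split; [|exact: stored_rcons|]; apply: stored_set => //; lia.
    apply: wp_seq; apply: wp_do; [reflexivity|lia|].
    rewrite /iset /iget /= k7 g1.
    set im4 := [eta _ with _ |-> _].
    have reg4 : registers n im4 by rewrite /registers /=.
    have [q3 q4 q5] : [/\ im4 3 = lo', im4 4 = hi' & im4 5 = p]%N by [].
    have q7 : im4 7%N = (n + (size out).+1)%N by rewrite /= addn1 addnS.
    move: rm5 im4 mem3 reg4 q3 q4 q5 q7 => rm5 im4 mem3.
    move=> [f0 f1 [f10 f11 f12 f13 f14]] q3 q4 q5 q7.
    have [ms3 _ mv3] := mem3.
    have rp : rm5 p = nth 0 s p by rewrite -ms3 // sn.
    have so1 : (size (rcons out (nth 0%R s p)) <= n)%N by rewrite size_rcons; lia.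
    have fin t2 (rm6 : nat -> R) : (t' <= t2 + 12)%N ->
        memory n rm6 s (rcons out (nth 0 s p))
          [:: x0; x1; M; c + Num.max (nth 0 s p) (- M); - M] ->
        I t2 (State im4 rm6).
      move=> ht2 mem6.
      exists lo', hi', (c + Num.max (nth 0 s p) (- M)), (rcons out (nth 0 s p)).
      by split=> //; split=> //; rewrite size_rcons //; lia.
    apply: wp_if; rewrite /= /rget /= ?f14 ?q5 ?rp ?(mv3 4%N) //=; first by lia.
      move=> xM; apply: (@wp_real 3 (c - M) _ _ _ _ n s _ _ _ _ mem3) => //.
      - by rewrite /= /rset /rget /= f13 f14 (mv3 3%N) // (mv3 4%N).
      - by lia.
      by move=> rm6 /= mem6; apply: fin; [lia|rewrite (max_idPr (ltW xM))].
    rewrite -leNgt => xM.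
    apply: (@wp_real 3 (c + nth 0 s p) _ _ _ _ n s _ _ _ _ mem3) => //.
    - by rewrite /= /rset /rget /= f13 q5 (mv3 3%N) // rp.
    - by lia.
    by move=> rm6 /= mem6; apply: fin; [lia|rewrite (max_idPl xM)].
  apply: wp_if; rewrite /= /rget /= ?e12 ?e13 ?(mv 3%N) ?(mv 2%N) //=.
  + by lia.
  + move=> cM; run; (apply: next; [by rewrite /registers|..]);
      by rewrite ?/lo' ?/hi' ?/p ?cM /= ?j3 ?j4 ?e1 ?subn1 //; lia.
  + move=> /negbTE cM; run; (apply: next; [by rewrite /registers|..]);
      by rewrite ?/lo' ?/hi' ?/p ?cM /= ?j3 ?j4 ?e1 ?addn1 //; lia.
- move=> t' [im2 rm4] [lo [hi [c [out /=
    [reg2 [j3 j4 j7] [lohi hin so] eq_out [mem2 ht']]]]]].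
  rewrite /iget /= j3 j4 -leqNgt => hilo.
  have hl0 : (hi - lo = 0)%N by lia.
  rewrite hl0 /= cats0 in eq_out; rewrite -eq_out in HQ.
  by apply: HQ reg2 _ _; [have [_ ? _] := mem2|lia].
exists 0%N, n, 0, [::]; split=> //=; first by rewrite addn0.
- by rewrite subn0.
- by rewrite subn0 /segment subn0 drop0 take_oversize ?sn.
- by split=> //; lia.
Qed.

(** * The whole program and its running time *)

Definition sss_program : cmd :=
  Seq merge_sort (Seq compute_bound (Seq greedy_loop copy_back)).

(** The linear part collects the budgets [20 * n + 20], [15 * n + 10] and [5 * n + 5] of the last
    three phases and the additive 5 of sorting. *)
Definition sss_time n := (40 * n.+1 * up_log 2 n + 40 * n + 40)%N.

Lemma sss_program_correct :
  computes_in_time sss_program (@balanced R) sss_time.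
Proof.
move=> A; rewrite /returns_within /balanced.
set s := sort _ A; set n := size A; set M := bound s (size s).
have sn : size s = n by rewrite size_sort.
rewrite sn; set out := greedy M 0 s n.
have so : size out = n by rewrite size_greedy.
have [t' [st [ex lt Q]]] : wp sss_program (fun _ st => stored (rmem st) 0 out)
    (sss_time n) (init A); last first.
  by exists t', st; split=> //; rewrite {1}(stored_mkseq Q) so.
apply: wp_seq; apply: (@wp_merge_sort _ _ _ _ _ n A) => //.
- by rewrite /sss_time; lia.
move=> t1 im1 rm1 [h0 h1] st1 ht1.
apply: wp_seq; apply: (@wp_compute_bound _ _ _ _ n s) => //.
- by move: ht1; rewrite /sss_time; lia.
move=> t2 im2 rm2 x0 x1 x3 x4 reg2 mem2 ht2.
apply: wp_seq; apply: (wp_greedy_loop sn reg2 mem2).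
- by move: ht1; rewrite /sss_time; lia.
have -> : bound s n = M by rewrite /M sn.
move=> t3 im3 rm3 [e0 e1 _] st3 ht3.
apply: (@wp_copy_back _ _ _ _ _ n (im3 2%N) out) => //.
- by move: ht1; rewrite /sss_time; lia.
Qed.

Lemma sss_time_bigO :
  (fun n : nat => (sss_time n)%:R : R) =O_\oo (fun n : nat => n%:R * ln n%:R : R).
Proof.
have ln2 : 0 < ln 2%:R :> R by rewrite ln_gt0 // ltr1n.
(* With [l = trunc_log 2 n], both [l * ln 2] and [ln 2] are at most [ln n], so
   [(80 * l + 160) * ln 2 <= 240 * ln n]; the constant 1000 is generous. *)
apply/eqOP; exists (1000 / ln 2%:R); split; first exact: num_real.
(* At [n = 1] the logarithm vanishes while the time bound does not, hence the threshold 2. *)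
move=> K hK; exists 2%N => // n /= n2.
have n0 : 0 < n%:R :> R by rewrite ltr0n; lia.
set L := ln n%:R.
have L2 : ln 2%:R <= L by rewrite /L ler_ln ?posrE ?ler_nat.
have L0 : 0 < L by apply: lt_le_trans L2.
rewrite (ger0_norm (ler0n _ _)) ger0_norm ?mulr_ge0 ?(ltW L0) ?(ltW n0) //.
have logL : (trunc_log 2 n)%:R * ln 2%:R <= L.
  rewrite /L mulrC mulr_natr -lnXn ?ltr0n // -natrX.
  rewrite ler_ln ?posrE ?ltr0n ?expn_gt0 //; last by lia.
  by rewrite ler_nat trunc_logP //; lia.
set l := trunc_log 2 n in logL.
have up : (up_log 2 n <= l.+1)%N.
  by rewrite up_log_min // ltnW // trunc_log_ltn.
(* This uses [n.+1 <= 2 * n], [up_log 2 n <= l.+1] and [40 <= 40 * n]. *)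
have T : (sss_time n <= n * (80 * l + 160))%N.
  rewrite /sss_time.
  have : (40 * n.+1 * up_log 2 n <= 40 * (2 * n) * l.+1)%N.
    by apply: leq_mul => //; lia.
  lia.
have T' : (sss_time n)%:R <= n%:R * (80 * l%:R + 160) :> R.
  by rewrite -[80]/(80%:R) -[160]/(160%:R) -natrM -natrD -natrM ler_nat.
apply: (le_trans T').
have : 80 * l%:R + 160 <= 1000 / ln 2%:R * L.
  rewrite mulrAC ler_pdivlMr //; nra.
have : 1000 / ln 2%:R * L <= K * L by rewrite ler_pM2r // ltW.
move=> h1 h2; rewrite mulrCA ler_pM2l //; lra.
Qed.

End Balancing.

Theorem theorem3 (R : realType) :
  exists (p : cmd) (f : seq R -> seq R) (T : nat -> nat),
    [/\ computes_in_time p f T,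
        (fun n : nat => (T n)%:R : R) =O_\oo (fun n : nat => n%:R * ln n%:R : R),
        forall A : seq R, perm_eq (f A) A,
        forall A : seq R, value (f A) <= 2%:R * OPT A
      & forall (q : {poly R}) (A : seq R), restricted q A ->
          value (f A) <= 3%:R / 2%:R * OPT A].
Proof.
exists sss_program, (@balanced R), sss_time; split.
- exact: sss_program_correct.
- exact: sss_time_bigO.
- exact: perm_balanced.
- exact: balanced_2approx.
- exact: balanced_restricted.
Qed.
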